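(* Let $N\ge 3$, let $\mathcal B_N$ be the complex spline space generated by the B-spline $B_N$ of order $N$, and let $\Gamma,\Gamma'\subset(0,1)$ be sets of $2N-1$ and $2N-5$ distinct points respectively. Then every nonzero function $f(x)=\sum_{k\in\mathbb Z}c_kB_N(x-k)\in\mathcal B_N$, with decomposition $f=\xi_1 f_{\rm L}+f_{\rm M}+\xi_2 f_{\rm R}$ as described in the context, which satisfies (i) $\sum_{l=0}^{N-2}|c_{k+l}|\neq 0$ for all integers $k\in(K_-(f)-N+1,\,K_+(f)+1)$, and (ii) provided that $\mathcal K(f)\ne\emptyset$, $\sum_{k-N+2\le n_1<n_2\le k}|\Im(c_{n_1}\overline{c_{n_2}})|\neq 0$ for all integers $k$ with $\kappa_-(f)+1\le k\le \kappa_+(f)+N-3$, can be determined, up to a unimodular constant and conjugation, from the phaseless Hermite samples $|f(\gamma)|$, $\gamma\in\Gamma+\mathbb Z$, and $|f'(\gamma')|$, $\gamma'\in\Gamma'+\mathbb Z$; that is, if $g\in\mathcal B_N$ satisfies $|g(\gamma)|=|f(\gamma)|$ for all $\gamma\in\Gamma+\mathbb Z$ and $|g'(\gamma')|=|f'(\gamma')|$ for all $\gamma'\in\Gamma'+\mathbb Z$, then $g=zf$ or $g=z\overline f$ for some $z\in\mathbb C$ with $|z|=1$.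
   Context: $\mathbb T=\{z\in\mathbb C: |z|=1\}$. The B-splines are defined by $B_1=\chi_{[0,1)}$ (the characteristic function of $[0,1)$) and $B_N=\int_0^1B_{N-1}(\cdot-t)\,dt$ for $N\ge2$. The complex spline space is $\mathcal B_N=\{\sum_{k\in\mathbb Z}c_kB_N(x-k): c_k\in\mathbb C\}$. ($B_N$ vanishes outside $[0,N]$ and its support length is $N$.) Decomposition. Let $f=\sum_k c_kB_N(\cdot-k)\in\mathcal B_N$ be nonzero. Conventions: $\inf\emptyset=+\infty$, $\sup\emptyset=-\infty$, $\pm\infty+n=\pm\infty$, and indices range over integers. Put $K_-(f)=\inf\{k: c_k\ne0\}$ and $K_+(f)=\sup\{k: c_k\ne 0\}$. For $\xi_1,\xi_2\in\mathbb T$ put $$\kappa_-=\kappa_-(f)=\sup\{k:\ \Im(\overline{\xi_1}c_l)=0 \text{ for all } l\le k\},\qquad \kappa_+=\kappa_+(f)=\inf\{k>\kappa_-:\ \Im(\overline{\xi_2}c_l)=0\text{ for all } l\ge k\},$$ where $\xi_1$ is chosen so that $\kappa_-$ is as large as possible, and then $\xi_2$ so that $\kappa_+$ is as small as possible. Put $$\mathcal K(f)=(\kappa_-,\kappa_+)\cap\mathbb Z\ \text{ if } \kappa_-+2\le\kappa_+<K_+(f)+1,\qquad \mathcal K(f)=\emptyset \text{ otherwise}.$$ The decomposition of $f$ is $f=\xi_1f_{\rm L}+f_{\rm M}+\xi_2f_{\rm R}$ with $f_{\rm L}=\sum_{k=K_-(f)}^{\kappa_-}a_kB_N(\cdot-k)$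 where $a_k=\overline{\xi_1}c_k\in\mathbb R$ for $k<\kappa_-+1$; $f_{\rm M}=\sum_{k\in\mathcal K(f)}c_kB_N(\cdot-k)$; and $f_{\rm R}=\sum_{k=\kappa_+}^{K_+(f)}a_kB_N(\cdot-k)$ where $a_k=\overline{\xi_2}c_k\in\mathbb R$ for $k\ge\kappa_+$ if $\kappa_+<K_+(f)+1$, and $f_{\rm R}=0$ otherwise. (Empty sums are zero.)
   Formalization: In the definition of 𝒦(f), κ₊ < K₊(f)+1 is replaced by κ₊ ≤ K₊(f); this differs only when κ₊ = K₊ = +∞, where the strict form makes (ii) void and the claim false (N=3, c_k=1+i if 3|k, else 1; conjugate c_0), so (ii) is then required for all k ≥ κ₋+1. *)

(* Defs.v *)
From HB Require Import structures.
From mathcomp Require Import all_boot all_order all_algebra.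
From mathcomp Require Import finmap complex.
From mathcomp Require Import all_classical all_reals all_analysis.
Set Implicit Arguments.
Unset Strict Implicit.
Unset Printing Implicit Defensive.
Import Order.TTheory GRing.Theory Num.Theory.
Import numFieldNormedType.Exports.
Local Open Scope classical_set_scope.
Local Open Scope complex_scope.
Local Open Scope ring_scope.

(* Only N >= 1 is meaningful; [bspline 0] is a dummy value. *)
Fixpoint bspline {R : realType} (N : nat) {struct N} : R -> R :=
  match N with
  | 0%N => fun=> 0
  | M.+1 => match M with
            | 0%N => \1_`[0, 1[
            | _.+1 => fun x =>
                \int[lebesgue_measure]_(t in `[0, 1]) bspline M (x - t)
            end
  end.

(* For every x only finitely many k satisfy bspline N (x - k) != 0 (see
   [bspline_out]), so the finite-support sum is the sum of the whole series. *)
Definition spline_on {R : realType} (N : nat) (A : set int) (c : int -> R[i])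
    : R -> R[i] :=
  fun x => \sum_(k \in A) c k * (bspline N (x - k%:~R))%:C%C.

Definition spline {R : realType} (N : nat) (c : int -> R[i]) : R -> R[i] :=
  spline_on N setT c.

Definition spline_space (R : realType) (N : nat) : set (R -> R[i]) :=
  [set f | exists c : int -> R[i], f = spline N c].
Arguments spline_space : clear implicits.

Definition cderive {R : realType} (f : R -> R[i]) (x : R) : R[i] :=
  (derive1 (fun y => complex.Re (f y)) x +i* derive1 (fun y => complex.Im (f y)) x)%C.

(* The quantities below are functions of the coefficient sequence c, which is
   determined by f = spline N c.  Extended integers are rendered as elements of
   \bar R; sup and inf of sets of integers taken there are integers or
   infinite, with the conventions sup set0 = -oo and inf set0 = +oo. *)
Definition eint {R : realType} (k : int) : \bar R := (k%:~R : R)%:E.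

Section decomposition.
Context {R : realType}.
Implicit Types (c : int -> R[i]) (xi : R[i]) (k l : int).

Definition Kminus c : \bar R := ereal_inf [set eint k | k in [set k | c k != 0]].

Definition Kplus c : \bar R := ereal_sup [set eint k | k in [set k | c k != 0]].

Definition kappa_minus c xi1 : \bar R :=
  ereal_sup [set eint k | k in
    [set k | forall l, l <= k -> complex.Im (xi1^*%C * c l) = 0]].

Definition kappa_plus c xi1 xi2 : \bar R :=
  ereal_inf [set eint k | k in
    [set k | (kappa_minus c xi1 < eint k)%E /\
             forall l, k <= l -> complex.Im (xi2^*%C * c l) = 0]].

Definition optimal_phases c xi1 xi2 : Prop :=
  [/\ `|xi1| = 1, `|xi2| = 1,
      forall xi, `|xi| = 1 -> (kappa_minus c xi <= kappa_minus c xi1)%E &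
      forall xi, `|xi| = 1 -> (kappa_plus c xi1 xi2 <= kappa_plus c xi1 xi)%E].

(* The last condition is the integer form of kappa_plus < K_plus + 1.  The two
   differ only when kappa_plus = K_plus = +oo: there the strict inequality fails
   because +oo + 1 = +oo, and an empty Kset would drop the coefficients beyond
   kappa_minus from the decomposition.  With <= the identity
   [spline_decomposition] holds for every c. *)
Definition Kset c xi1 xi2 : set int :=
  [set k | [/\ (kappa_minus c xi1 < eint k < kappa_plus c xi1 xi2)%E,
               (kappa_minus c xi1 + 2%:E <= kappa_plus c xi1 xi2)%E &
               (kappa_plus c xi1 xi2 <= Kplus c)%E]].

Definition left_part (N : nat) c xi1 : R -> R[i] :=
  spline_on N [set k | (Kminus c <= eint k <= kappa_minus c xi1)%E]
    (fun k => xi1^*%C * c k).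

Definition mid_part (N : nat) c xi1 xi2 : R -> R[i] :=
  spline_on N (Kset c xi1 xi2) c.

(* If kappa_plus >= K_plus + 1 then the index set is empty and the sum is 0. *)
Definition right_part (N : nat) c xi1 xi2 : R -> R[i] :=
  spline_on N [set k | (kappa_plus c xi1 xi2 <= eint k <= Kplus c)%E]
    (fun k => xi2^*%C * c k).

Lemma le_eint k l : ((eint k : \bar R) <= eint l)%E = (k <= l).
Proof. by rewrite /eint lee_fin ler_int. Qed.

Lemma lt_eint k l : ((eint k : \bar R) < eint l)%E = (k < l).
Proof. by rewrite /eint lte_fin ltr_int. Qed.

Lemma bspline_out (N : nat) (x : R) : x < 0 \/ N%:R <= x -> bspline N x = 0.
Proof.
elim: N x => [//|[|M] IH] x hx.
  rewrite /= indicE; case: (boolP (x \in _)) => //.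
  rewrite inE /= in_itv /= => /andP[x0 x1].
  by case: hx; rewrite ?ltNge ?x0// leNgt x1.
rewrite [LHS]/= /Rintegral integral0_eq// => t /=.
rewrite in_itv/= => /andP[t0 t1]; congr EFin; apply: IH.
case: hx => hx; [left|right].
  by rewrite subr_lt0 (lt_le_trans hx).
by rewrite lerBrDr (le_trans _ hx)// [in leRHS]mulrSr lerD2l.
Qed.

Lemma bspline_finite (N : nat) (x : R) :
  finite_set [set k : int | bspline N (x - k%:~R) != 0].
Proof.
apply: (@sub_finite_set _ _
    ((fun j : nat => Num.floor x - N%:Z + j%:Z) @` `I_N.+1)); last first.
  exact/finite_image/finite_II.
move=> k /= nz.
have [h|h] := ltP (x - k%:~R) 0; first by rewrite bspline_out ?eqxx in nz; last left.
have [h'|h'] := leP N%:R (x - k%:~R).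
  by rewrite bspline_out ?eqxx in nz; last right.
have k1 : k <= Num.floor x by rewrite floor_ge_int -subr_ge0.
have k2 : Num.floor x - N%:Z < k.
  rewrite ltrBlDr -(ltr_int R) (le_lt_trans (floor_le_tmp x))//.
  by rewrite intrD -ltrBlDl.
have k3 : 0 <= k - (Num.floor x - N%:Z) by rewrite subr_ge0 ltW.
exists (absz (k - (Num.floor x - N%:Z))%R).
  by rewrite /= ltnS -lez_nat gez0_abs// lerBlDr addrCA subrr addr0.
by rewrite gez0_abs// addrC subrK.
Qed.

Lemma spline_onE (N : nat) (A : set int) c (x : R) :
  spline_on N A c x =
  \sum_(k \in [set k : int | bspline N (x - k%:~R) != 0])
    (if k \in A then c k else 0) * (bspline N (x - k%:~R))%:C%C.
Proof.
rewrite /spline_on fsbig_mkcond; symmetry.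
rewrite (fsbig_widen [set k : int | bspline N (x - k%:~R) != 0] [set: int])//=.
  by apply: eq_fsbigr => k _; rewrite /patch; case: ifP; rewrite ?mul0r.
by move=> k [_ /=] /negP; rewrite negbK => /eqP ->; rewrite mulr0.
Qed.

Lemma conjc_mulK xi (z : R[i]) : `|xi| = 1 -> xi * (xi^*%C * z) = z.
Proof.
move=> h; rewrite mulrA.
suff -> : xi * xi^*%C = 1 by rewrite mul1r.
by have := normCK xi; rewrite h expr1n => <-.
Qed.

Lemma exists_phase (z : R[i]) :
  exists2 xi, `|xi| = 1 & complex.Im (xi^*%C * z) = 0.
Proof.
have [->|z0] := eqVneq z 0; first by exists 1; rewrite ?normr1 ?mulr0.
exists (z * ((ComplexField.Normc.normc z)^-1)%:C%C).
  rewrite normrM; case: z z0 => a b z0; rewrite normc_def/=.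
  set r := Num.sqrt _.
  have r0 : r != 0.
    apply: contra_neq z0 => r0; apply: (@ComplexField.Normc.eq0_normc R).
    by rewrite /= -/r r0.
  rewrite normc_def/= expr0n/= addr0 sqrtr_sqr ger0_norm ?invr_ge0 ?sqrtr_ge0//.
  by rewrite -[LHS]rmorphM/= divff.
case: z {z0} => a b /=; set r := Num.sqrt _.
rewrite !mulr0 subr0 add0r mulNr [a / r * b]mulrAC [b / r * a]mulrAC.
by rewrite [b * a]mulrC addrN.
Qed.

Lemma eint_gt_inf (A : set int) k : (ereal_inf [set eint j | j in A] <= eint k :> \bar R)%E ->
  exists2 j, A j & j <= k.
Proof.
move=> h.
have /ereal_inf_lt : (ereal_inf [set eint j | j in A] < eint (k + 1) :> \bar R)%E.
  by rewrite (le_lt_trans h)// lt_eint ltrDl.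
by case=> _ [j Aj <-]; rewrite lt_eint ltzD1; exists j.
Qed.

Lemma eint_lt_sup (A : set int) k : (eint k <= ereal_sup [set eint j | j in A] :> \bar R)%E ->
  exists2 j, A j & k <= j.
Proof.
move=> h.
have /ereal_sup_gt : (eint (k - 1) < ereal_sup [set eint j | j in A] :> \bar R)%E.
  by rewrite (lt_le_trans _ h)// lt_eint gtrDl.
by case=> _ [j Aj <-]; rewrite lt_eint ltrBlDr ltzD1; exists j.
Qed.

Lemma same_phase xi xi0 (z w : R[i]) : `|xi0| = 1 -> z != 0 ->
  complex.Im (xi^*%C * z) = 0 -> complex.Im (xi0^*%C * z) = 0 ->
  complex.Im (xi0^*%C * w) = 0 -> complex.Im (xi^*%C * w) = 0.
Proof.
move=> n0 z0 hz hz0 hw.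
have real (u : R[i]) : complex.Im u = 0 -> u = (complex.Re u)%:C%C.
  by case: u => a b /= ->.
have e : xi^*%C * w * (xi0^*%C * z) = xi0^*%C * w * (xi^*%C * z).
  by rewrite mulrACA [RHS]mulrACA [xi^*%C * _]mulrC.
rewrite (real _ hz) (real _ hz0) (real _ hw) in e.
have r0 : complex.Re (xi0^*%C * z) != 0.
  apply: contra_neq z0 => r0; rewrite -(conjc_mulK z n0) (real _ hz0) r0.
  exact: mulr0.
move/(congr1 (@complex.Im R)): e; case: (xi^*%C * w) => a b /=.
by rewrite !mulr0 mul0r !addr0 add0r => /eqP; rewrite mulf_eq0 (negbTE r0) orbF => /eqP.
Qed.

Lemma first_nonzero c k m : (forall l, l <= k -> c l = 0) -> c m != 0 ->
  exists2 j, c j != 0 & forall l, l < j -> c l = 0.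
Proof.
move=> hk cm.
have km l : c l != 0 -> k <= l.
  by move=> cl; rewrite leNgt; apply/negP => /ltW/hk/eqP; rewrite (negbTE cl).
have ex : exists n : nat, c (k + n%:Z) != 0.
  by exists (absz (m - k)%R); rewrite gez0_abs ?subr_ge0 ?km// addrC subrK.
case: (ex_minnP ex) => n cn minn; exists (k + n%:Z) => // l ln.
apply/eqP/negPn/negP => cl; have kl := km _ cl.
have := minn (absz (l - k)%R); rewrite gez0_abs ?subr_ge0// addrC subrK.
move=> /(_ cl); rewrite -lez_nat gez0_abs ?subr_ge0// lerBrDl.
by rewrite leNgt ln.
Qed.

Lemma last_nonzero c k m : (forall l, k <= l -> c l = 0) -> c m != 0 ->
  exists2 j, c j != 0 & forall l, j < l -> c l = 0.
Proof.
move=> hk cm.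
have [||j cj hj] := @first_nonzero (fun l => c (- l)) (- k) (- m).
- by move=> l lk; apply: hk; rewrite lerNr.
- by rewrite opprK.
exists (- j) => // l jl; rewrite -[l]opprK; apply: hj.
by rewrite ltrNl.
Qed.

Lemma optimal_phases_exist c : (exists k, c k != 0) ->
  exists xi1 xi2, optimal_phases c xi1 xi2.
Proof.
move=> [k0 ck0].
have [xi1 n1 opt1] : exists2 xi1, `|xi1| = 1 &
    forall xi, `|xi| = 1 -> (kappa_minus c xi <= kappa_minus c xi1)%E.
  have [[m [xi0 [n0 cm hm]]]|none] := pselect (exists m xi0,
    [/\ `|xi0| = 1, c m != 0 & forall l, l <= m -> complex.Im (xi0^*%C * c l) = 0]).
    exists xi0 => // xi n; apply: ge_ereal_sup => _ [k /= hk <-].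
    apply: ereal_sup_ubound; exists k => //= l lk.
    have [lm|ml] := leP l m; first exact: hm.
    have mk := le_trans (ltW ml) lk.
    exact: (same_phase n cm (hm _ (lexx _)) (hk _ mk) (hk _ lk)).
  exists 1; first exact: normr1.
  move=> xi n; apply: ge_ereal_sup => _ [k /= hk <-]; exfalso.
  have [|m cm hm] := @first_nonzero c k k0 _ ck0.
    move=> l lk; apply/eqP/negPn/negP => cl; apply: none; exists l, xi; split=> //.
    by move=> l' ll'; apply/hk/(le_trans ll').
  have [xi0 n0 h0] := exists_phase (c m); apply: none; exists m, xi0; split => // l.
  by rewrite le_eqVlt => /orP[/eqP->//|/hm ->]; rewrite mulr0.
suff [xi2 n2 opt2] : exists2 xi2, `|xi2| = 1 &
    forall xi, `|xi| = 1 -> (kappa_plus c xi1 xi2 <= kappa_plus c xi1 xi)%E.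
  by exists xi1, xi2.
have [[m [xi0 [n0 cm km hm]]]|none] := pselect (exists m xi0,
  [/\ `|xi0| = 1, c m != 0, (kappa_minus c xi1 < eint m)%E &
     forall l, m <= l -> complex.Im (xi0^*%C * c l) = 0]).
  exists xi0 => // xi n; apply: le_ereal_inf_tmp => _ [k /= [kk hk] <-].
  apply: ereal_inf_lbound; exists k => //=; split => // l lk.
  have [lm|ml] := leP m l; first exact: hm.
  have mk := le_trans lk (ltW ml).
  exact: (same_phase n cm (hm _ (lexx _)) (hk _ mk) (hk _ lk)).
exists 1; first exact: normr1.
move=> xi n; apply: le_ereal_inf_tmp => _ [k /= [kk hk] <-]; exfalso.
have hk0 l : k <= l -> c l = 0.
  move=> lk; apply/eqP/negPn/negP => cl; apply: none; exists l, xi; split=> //.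
    by rewrite (lt_le_trans kk)// le_eint.
  by move=> l' ll'; apply/hk/(le_trans lk).
have [m cm hm] := last_nonzero hk0 ck0.
have [mk|km] := leP (eint m) (kappa_minus c xi1); last first.
  have [xi0 h00 h0] := exists_phase (c m); apply: none; exists m, xi0; split => // l.
  by rewrite le_eqVlt => /orP[/eqP<-//|/hm ->]; rewrite mulr0.
have [j /= hj mj] := eint_lt_sup mk.
move: kk; rewrite ltNge => /negP; apply; apply: ereal_sup_ubound; exists k => //= l lk.
have [lj|jl] := leP l j; first exact: hj.
by rewrite hm ?mulr0// (le_lt_trans mj).
Qed.

Lemma spline_decomposition (N : nat) c xi1 xi2 : optimal_phases c xi1 xi2 ->
  forall x : R, spline N c x = xi1 * left_part N c xi1 x + mid_part N c xi1 xi2 x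
                     + xi2 * right_part N c xi1 xi2 x.
Proof.
move=> [n1 n2 _ opt] x.
rewrite /spline /left_part /mid_part /right_part !spline_onE.
have fin := bspline_finite N x.
rewrite !fsbig_finite// !big_distrr/= -!big_split/=; apply: eq_bigr => k _.
rewrite in_setT !mulrA -!mulrDl; congr (_ * _).
rewrite (fun_if ( *%R xi1)) (fun_if ( *%R xi2)) !mulr0 !conjc_mulK//.
have [ck0|ck] := eqVneq (c k) 0; first by rewrite ck0 !if_same !addr0.
have Kmk : (Kminus c <= eint k)%E by apply: ereal_inf_lbound; exists k.
have Kpk : (eint k <= Kplus c)%E by apply: ereal_sup_ubound; exists k.
have [kL|kL] := leP (eint k) (kappa_minus c xi1).
  rewrite mem_set/= ?Kmk// memNset/=; last by rewrite /Kset/= ltNge kL => -[].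
  rewrite memNset/= ?addr0// => /andP[/eint_gt_inf[j [/= mj _] jk] _].
  by move: mj; rewrite ltNge (le_trans _ kL)// le_eint.
rewrite memNset/=; last by rewrite Kmk leNgt kL.
have [kR|kR] := leP (kappa_plus c xi1 xi2) (eint k).
  rewrite memNset/=; last by rewrite /Kset/= [X in _ && X]ltNge kR andbF => -[].
  by rewrite mem_set/= ?kR// !add0r.
rewrite mem_set/=; last first.
  split; first by rewrite kL.
    have lem : (kappa_minus c xi1 <= eint (k - 1))%E.
      apply: ge_ereal_sup => _ [j /= hj <-]; rewrite le_eint -ltzD1 subrK ltNge.
      apply/negP => kj; move: kL; rewrite ltNge => /negP; apply.
      by apply: ereal_sup_ubound; exists k => //= l lk; apply/hj/(le_trans lk).
    have lep : (eint (k + 1) <= kappa_plus c xi1 xi2)%E.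
      apply: le_ereal_inf_tmp => _ [j /= hj <-]; rewrite le_eint lezD1 ltNge.
      apply/negP => jk; move: kR; rewrite ltNge => /negP; apply.
      by apply: (@le_trans _ _ (eint j)); [apply: ereal_inf_lbound; exists j|rewrite le_eint].
    apply: (le_trans _ lep); apply: (le_trans (leeD2r _ lem)).
    by rewrite /eint -EFinD lee_fin -[2]/(2%:~R) -intrD ler_int -addrA.
  case: (pselect (exists2 m, c m != 0 & forall l, m < l -> c l = 0)).
    move=> [m cm hm].
    have km : k <= m by rewrite leNgt; apply/negP => /hm/eqP; rewrite (negbTE ck).
    have [xi xin xim] := exists_phase (c m).
    apply: (le_trans (opt _ xin)); apply: (@le_trans _ _ (eint m)).
      apply: ereal_inf_lbound; exists m => //=; split.
        by rewrite (lt_le_trans kL)// le_eint.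
      by move=> l; rewrite le_eqVlt => /orP[/eqP<-//|/hm ->]; rewrite mulr0.
    by apply: ereal_sup_ubound; exists m.
  move=> nex; suff -> : Kplus c = +oo%E by rewrite leey.
  have unb n : exists2 m, c m != 0 & k + n%:Z <= m.
    elim: n => [|n [m cm hm]]; first by exists k; rewrite ?addr0.
    apply: contrapT => nm; apply: nex; exists m => // l ml.
    apply/eqP/negPn/negP => cl; apply: nm; exists l => //.
    by rewrite intS addrCA addrC lezD1 (le_lt_trans hm).
  apply/eqyP => A A0; pose n := absz (Num.ceil A - k)%R.
  have [m cm hm] := unb n.
  apply: (@le_trans _ _ (eint m)); last by apply: ereal_sup_ubound; exists m.
  rewrite /eint lee_fin (le_trans (@ceil_ge _ A))// ler_int (le_trans _ hm)//.
  by rewrite -lerBlDl /n (le_trans (ler_norm _))// abszE.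
rewrite memNset/= ?addr0 ?add0r// => /andP[]; by rewrite leNgt kR.
Qed.
End decomposition.

(* Main.v *)
Require Import Defs.
From mathcomp Require Import all_boot all_order all_algebra.
From mathcomp Require Import finmap complex.
From mathcomp Require Import all_classical all_reals all_analysis.
From mathcomp Require Import measurable_realfun ring lra zify.
Import Order.TTheory GRing.Theory Num.Theory.
Import numFieldNormedType.Exports.
Local Open Scope classical_set_scope.
Local Open Scope complex_scope.
Local Open Scope ring_scope.

(** On [[k, k+1)] a spline of order N is a polynomial of degree at most N-1 in
    the local variable, and its N coefficients in the basis of B-spline pieces
    are c_{k-N+1}, ..., c_k ([spline_window], [bspline_piece_free]).  Let p and q
    be these polynomials for f and g, and p*, q* their coefficientwise
    conjugates, so that |f|^2 and |g|^2 are the values of p p* and q q*.  The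
    difference p p* - q q* has degree at most 2N-2 and vanishes at the 2N-1
    points of Gamma, hence p p* = q q*.  The two top coefficients of p' p*' are
    fixed multiples of those of p p*, so p' p*' - q' q*' has degree at most
    2N-6, and its 2N-5 zeros at the points of Gamma' give p' p*' = q' q*'.  The
    logarithmic derivatives of p and p* now have the same sum and the same
    product as those of q and q*; hence q has the logarithmic derivative of p or
    of p*, that is q = z p or q = z p* with |z| = 1 ([phase_retrieval_real]).

    For every k this yields a unimodular z with d_l = z c_l, or d_l = z c_l^*,
    for all l in the window k-N < l <= k.  Consecutive windows share the N-1
    indices of [overlap], and two things have to be propagated through the
    overlaps.

    The alternative (c or its conjugate).  If the coefficients of f on an overlap
    do not lie on one real line through the origin, only one alternative is
    possible there, so both windows use the same one.  If they do lie on one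
    line, then so do the coefficients of all windows on the left, or those of
    all windows on the right ([aligned_overlap_split]): this is what the
    decomposition into f_L, f_M, f_R and condition (ii) give.  On such windows
    both alternatives hold, and one alternative therefore works for all windows
    ([global_alternative]).

    The constant z.  A nonzero coefficient in an overlap forces the constants of
    the two windows to agree.  By condition (i) an overlap on which c vanishes
    has only zero coefficients on one of its sides
    ([vanishing_overlap_split]), so the constant is the same for all windows
    that matter ([global_phase]). *)

(** * Products of polynomials and their derivatives *)

Lemma coefM_top (A : nzRingType) (p q : {poly A}) (m n : nat) :
  (size p <= m.+1)%N -> (size q <= n.+1)%N -> (p * q)`_(m + n) = p`_m * q`_n.
Proof.
move=> sp sq; rewrite coefM.
rewrite (bigD1 (inord m)) //= inordK ?ltnS ?leq_addr// addKn big1 ?addr0// => i.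
rewrite -val_eqE /= inordK ?ltnS ?leq_addr// => im.
have [mi|] := ltnP m i; first by rewrite (leq_sizeP _ _ sp) ?mul0r.
rewrite leq_eqVlt (negPf im) /= => lt.
by rewrite [q`__](leq_sizeP _ _ sq) ?mulr0// ltn_subRL ltn_add2r.
Qed.

Lemma coefM_subtop (A : nzRingType) (p q : {poly A}) (n : nat) :
  (size p <= n.+2)%N -> (size q <= n.+2)%N ->
  (p * q)`_(n.+1 + n) = p`_n.+1 * q`_n + p`_n * q`_n.+1.
Proof.
move=> sp sq; rewrite coefM.
have h1 : (n.+1 < (n.+1 + n).+1)%N by rewrite ltnS leq_addr.
have h0 : (n < (n.+1 + n).+1)%N by rewrite ltnS leq_addl.
rewrite (bigD1 (Ordinal h1)) //= (bigD1 (Ordinal h0)) /=; last first.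
  by rewrite -val_eqE /= neq_ltn ltnSn.
rewrite addKn addnK big1 ?addr0// => i.
rewrite -!val_eqE /= => /andP[i1 i0].
have [ni|] := ltnP n.+1 i; first by rewrite (leq_sizeP _ _ sp) ?mul0r.
rewrite leq_eqVlt (negPf i1) /= ltnS leq_eqVlt (negPf i0) /= => lt.
rewrite [q`__](leq_sizeP _ _ sq) ?mulr0// ltn_subRL.
by move: (nat_of_ord i) lt => k lt; rewrite addSnnS ltn_add2r.
Qed.

(** The product by 'X makes the top coefficients of 'X q' p and 'X p' q equal to
    those of q p times the degree of q, respectively p.  In characteristic 0 the
    degrees must agree. *)
Lemma wronskian0_size (K : numFieldType) (p q : {poly K}) : p != 0 -> q != 0 ->
  q^`() * p = p^`() * q -> size p = size q.
Proof.
move=> p0 q0 W.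
have [m sp] : exists m, size p = m.+1 by exists (size p).-1; rewrite prednK ?lt0n ?size_poly_eq0.
have [n sq] : exists n, size q = n.+1 by exists (size q).-1; rewrite prednK ?lt0n ?size_poly_eq0.
have sX (r : {poly K}) k : size r = k.+1 -> (size ('X * r^`())%R <= k.+1)%N.
  move=> sr; apply/leq_sizeP => -[//|j] kj.
  by rewrite coefXM /= coef_deriv (leq_sizeP _ _ _ j.+1 kj) ?sr// mul0rn.
have cX (r : {poly K}) k : ('X * r^`())`_k = k%:R * r`_k.
  by case: k => [|k]; rewrite coefXM ?mul0r//= coef_deriv mulr_natl.
have := congr1 (fun r : {poly K} => ('X * r)`_(m + n)) W.
rewrite !mulrA [in LHS](addnC m) !coefM_top ?sX ?sp ?sq// !cX.
have nzp : p`_m != 0 by have := p0; rewrite -lead_coef_eq0 lead_coefE sp.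
have nzq : q`_n != 0 by have := q0; rewrite -lead_coef_eq0 lead_coefE sq.
rewrite -!mulrA [p`_m * _]mulrC => /eqP.
by rewrite (inj_eq (mulIf (mulf_neq0 nzq nzp))) eqr_nat => /eqP ->.
Qed.

(** Subtracting from q the multiple of p with the same leading coefficient leaves
    a polynomial of smaller degree whose Wronskian with p is still 0; by
    [wronskian0_size] it can only be 0. *)
Lemma wronskian0_proportional (K : numFieldType) (p q : {poly K}) : p != 0 ->
  q^`() * p = p^`() * q -> exists z, q = z *: p.
Proof.
move=> p0 W; have [->|q0] := eqVneq q 0; first by exists 0; rewrite scale0r.
have sz := wronskian0_size _ _ _ p0 q0 W.
pose z := lead_coef q / lead_coef p; exists z; apply/eqP; rewrite -subr_eq0.
apply/negPn/negP => e0.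
have := wronskian0_size _ _ _ p0 e0; rewrite derivB derivZ mulrBl mulrBr W.
rewrite -scalerAl -scalerAr => /(_ erefl) sz'.
have lp : lead_coef p != 0 by rewrite lead_coef_eq0.
have : (q - z *: p)`_(size p).-1 == 0.
  by rewrite coefB coefZ -!lead_coefE {1}sz -lead_coefE /z divfK ?subrr.
by rewrite [in X in _`_X]sz' -lead_coefE lead_coef_eq0 (negPf e0).
Qed.

(** The logarithmic derivatives of p and ps are the two roots of a quadratic
    polynomial whose coefficients are determined by p ps, p' ps' and the
    derivative of p ps.  That of q is a root of the same quadratic; after clearing
    denominators this is the vanishing of a product of two Wronskians. *)
Lemma phase_retrieval_poly (K : numFieldType) (p ps q qs : {poly K}) :
  p * ps = q * qs -> p^`() * ps^`() = q^`() * qs^`() -> p != 0 -> ps != 0 ->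
  exists z, q = z *: p \/ q = z *: ps.
Proof.
move=> e e' p0 ps0.
have d := congr1 deriv e; rewrite !derivM in d.
have : (q^`() * p - p^`() * q) * (q^`() * ps - ps^`() * q) == 0.
  apply/eqP; transitivity (q^`() ^+ 2 * (p * ps)
      - q^`() * q * (p^`() * ps + p * ps^`()) + p^`() * ps^`() * q ^+ 2); first by ring.
  by rewrite e e' d; ring.
rewrite mulf_eq0 !subr_eq0 => /orP[] /eqP /wronskian0_proportional.
  by case=> // z qE; exists z; left.
by case=> // z qE; exists z; right.
Qed.

(** For degree m = n+2, the coefficients of p' ps' in degrees 2m-2 and 2m-3 are
    m^2 and m(m-1) times those of p ps in degrees 2m and 2m-1.  Equality of the
    products thus removes the two top terms of the difference, which is why
    fewer samples of the derivative suffice. *)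
Lemma size_derivM_diff (K : numFieldType) (p ps q qs : {poly K}) (n : nat) :
  (size p <= n.+3)%N -> (size ps <= n.+3)%N -> (size q <= n.+3)%N -> (size qs <= n.+3)%N ->
  p * ps = q * qs -> (size (p^`() * ps^`() - q^`() * qs^`())%R <= n + n.+1)%N.
Proof.
move=> sp sps sq sqs e.
have sd (r : {poly K}) : (size r <= n.+3)%N -> (size r^`() <= n.+2)%N.
  move=> sr; apply/leq_sizeP => j nj.
  by rewrite coef_deriv (leq_sizeP _ _ sr) ?mul0rn.
have top := congr1 (fun r : {poly K} => r`_(n.+2 + n.+2)) e.
have sub := congr1 (fun r : {poly K} => r`_(n.+2 + n.+1)) e.
rewrite !coefM_top// in top; rewrite !coefM_subtop// in sub.
have sM (r s : {poly K}) : (size r <= n.+3)%N -> (size s <= n.+3)%N ->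
    (size (r^`() * s^`())%R <= (n.+1 + n.+1).+1)%N.
  move=> /sd hr /sd hs; apply: leq_trans (size_polyMleq _ _) _.
  have := leq_add hr hs; case: (size _ + size _)%N => //= k.
  by rewrite addnS.
apply/leq_sizeP => j nj.
have [big|] := ltnP (n.+1 + n.+1) j.
  rewrite coefB (leq_sizeP _ _ (sM _ _ sp sps))// (leq_sizeP _ _ (sM _ _ sq sqs))//.
  exact: subrr.
rewrite leq_eqVlt => /orP[/eqP ->|jl].
  rewrite coefB !coefM_top ?sd// !coef_deriv.
  have arr (a b : K) : a *+ n.+2 * (b *+ n.+2) = a * b * n.+2%:R ^+ 2.
    by rewrite -[a *+ _]mulr_natr -[b *+ _]mulr_natr; ring.
  by rewrite !arr top subrr.
have -> : j = (n.+1 + n)%N.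
  by apply/eqP; rewrite eqn_leq -ltnS -addnS jl addnC.
rewrite coefB !coefM_subtop ?sd// !coef_deriv.
have arr (a b c d : K) : a *+ n.+2 * (b *+ n.+1) + c *+ n.+1 * (d *+ n.+2) =
   (a * b + c * d) * (n.+2%:R * n.+1%:R).
  rewrite -[a *+ _]mulr_natr -[b *+ _]mulr_natr -[c *+ _]mulr_natr -[d *+ _]mulr_natr.
  by ring.
by rewrite !arr sub subrr.
Qed.

Lemma roots_poly0 (K : idomainType) (p : {poly K}) (rs : seq K) :
  uniq rs -> (forall x, x \in rs -> root p x) -> (size p <= size rs)%N -> p = 0.
Proof.
move=> u r s; apply/eqP/negPn/negP => p0.
have := max_poly_roots p0 _ u; rewrite ltnNge s => /(_ _)/negP; apply => //.
by apply/allP => x /r.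
Qed.

(** * Polynomial pieces of the B-splines *)

Definition primitive_poly {K : fieldType} (p : {poly K}) : {poly K} :=
  \poly_(i < (size p).+1) (p`_i.-1 / i%:R).

Lemma coef_primitive (K : fieldType) (p : {poly K}) i :
  (primitive_poly p)`_i = p`_i.-1 / i%:R.
Proof.
rewrite coef_poly; case: ltnP => //; case: i => // i.
by rewrite ltnS /= => h; rewrite (leq_sizeP _ _ h) ?mul0r.
Qed.

Lemma size_primitive (K : fieldType) (p : {poly K}) :
  (size (primitive_poly p) <= (size p).+1)%N.
Proof. exact: size_poly. Qed.

Lemma primitive_polyD (K : fieldType) (p q : {poly K}) :
  primitive_poly (p + q) = primitive_poly p + primitive_poly q.
Proof. by apply/polyP => i; rewrite !(coefD, coef_primitive) mulrDl. Qed.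

Lemma primitive_poly0 (K : fieldType) : primitive_poly (0 : {poly K}) = 0.
Proof. by apply/polyP => i; rewrite coef_primitive !coef0 mul0r. Qed.

Lemma primitive_poly1 (K : fieldType) : primitive_poly (1 : {poly K}) = 'X.
Proof.
apply/polyP => -[|[|i]]; rewrite coef_primitive coefX coef1 /=.
- by rewrite invr0 mulr0.
- by rewrite invr1 mulr1.
- by rewrite mul0r.
Qed.

Lemma primitive_poly_sum (K : fieldType) (F : nat -> {poly K}) n :
  primitive_poly (\sum_(j < n) F j) = \sum_(j < n) primitive_poly (F j).
Proof.
elim: n => [|n IH]; first by rewrite !big_ord0 primitive_poly0.
by rewrite !big_ord_recr/= primitive_polyD IH.
Qed.

Lemma primitive_poly_at0 (K : fieldType) (p : {poly K}) :
  (primitive_poly p).[0] = 0.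
Proof. by rewrite horner_coef0 coef_primitive invr0 mulr0. Qed.

Lemma deriv_primitive (K : numFieldType) (p : {poly K}) :
  (primitive_poly p)^`() = p.
Proof.
apply/polyP => i; rewrite coef_deriv coef_primitive /= -[LHS]mulr_natr.
by rewrite divfK// pnatr_eq0.
Qed.

(** [bspline_piece M j] gives [bspline M.+1 (x + j)] for x in [[0, 1)].  The
    recursion splits the integral of [bspline M'.+1 (x + j - t)] over t in [0, 1]
    at t = x: for t <= x the argument lies in
    [[j, j+1)], for t > x in [[j-1, j)].  The coefficient field is arbitrary so
    that real values and complex linear combinations use the same family. *)
Fixpoint bspline_piece {K : fieldType} (M j : nat) : {poly K} :=
  match M with
  | 0%N => if j is 0%N then 1 else 0
  | M'.+1 =>
      primitive_poly (bspline_piece M' j) +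
      (if j is i.+1 then
         ((primitive_poly (bspline_piece M' i)).[1])%:P -
         primitive_poly (bspline_piece M' i)
       else 0)
  end.

Lemma bspline_piece_out (K : fieldType) M j : (M < j)%N ->
  bspline_piece M j = 0 :> {poly K}.
Proof.
elim: M j => [|M IH] [|j]//= Mj.
rewrite !IH// ?primitive_poly0 ?horner0 ?subr0 ?addr0//.
exact: ltnW.
Qed.

Lemma size_bspline_piece (K : fieldType) M j :
  (size (bspline_piece M j : {poly K}) <= M.+1)%N.
Proof.
elim: M j => [|M IH] [|j]/=; rewrite ?size_poly1 ?size_poly0//.
  by rewrite addr0 (leq_trans (size_primitive _ _)) ?ltnS ?IH.
rewrite (leq_trans (size_polyD _ _))// geq_max.
rewrite (leq_trans (size_primitive _ _)) ?ltnS ?IH//=.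
rewrite (leq_trans (size_polyD _ _))// geq_max size_polyN.
rewrite (leq_trans (size_primitive _ _)) ?ltnS ?IH// andbT.
by rewrite (leq_trans (size_polyC_leq1 _)).
Qed.

Lemma deriv_bspline_piece (K : numFieldType) M j :
  (bspline_piece M.+1 j : {poly K})^`() =
  bspline_piece M j - (if j is i.+1 then bspline_piece M i else 0).
Proof.
case: j => [|j] /=; rewrite derivD deriv_primitive ?deriv0 ?subr0 ?addr0//.
by rewrite derivB derivC deriv_primitive sub0r.
Qed.

(** The primitives telescope in the recursion, and what remains is the integral
    over [0, 1] of the sum of the pieces of the previous order. *)
Lemma bspline_piece_partition (K : numFieldType) M :
  \sum_(j < M.+1) bspline_piece M j = 1 :> {poly K}.
Proof.
elim: M => [|M IH]; first by rewrite big_ord_recl big_ord0 addr0.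
rewrite /= big_split/= big_ord_recr/= bspline_piece_out// primitive_poly0 addr0.
rewrite [X in _ + X]big_ord_recl add0r/= sumrB addrCA subrr addr0.
by rewrite -rmorph_sum/= -horner_sum -primitive_poly_sum IH primitive_poly1 hornerX.
Qed.

(** Differentiating a vanishing combination gives one of the previous order, with
    coefficients a_j - a_{j+1}.  By induction all a_j are equal, and then the
    partition of unity makes their common value 0. *)
Lemma bspline_piece_free (K : numFieldType) M (a : nat -> K) :
  \sum_(j < M.+1) a j *: bspline_piece M j = 0 -> forall j, (j <= M)%N -> a j = 0.
Proof.
elim: M a => [|M IH] a.
  rewrite big_ord_recl big_ord0 addr0/= => /eqP.
  by rewrite alg_polyC polyC_eq0 => /eqP a0 [].
move=> S0.
have step j : (j <= M)%N -> a j = a j.+1.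
  move=> jM; apply/eqP; rewrite -subr_eq0; apply/eqP.
  apply: (IH (fun j => a j - a j.+1)) jM.
  have := congr1 deriv S0; rewrite deriv0 raddf_sum/=.
  under eq_bigr => i _ do rewrite derivZ deriv_bspline_piece scalerBr.
  rewrite sumrB big_ord_recr/= bspline_piece_out// scaler0 addr0.
  rewrite [X in _ - X]big_ord_recl scaler0 add0r/= -sumrB => S1.
  rewrite -[RHS]S1; by apply: eq_bigr => i _; rewrite scalerBl.
have cst j : (j <= M.+1)%N -> a j = a 0%N.
  by elim: j => // j IHj jM; rewrite -step// IHj// ltnW.
have : a 0%N *: \sum_(j < M.+2) bspline_piece M.+1 j = 0 :> {poly K}.
  rewrite scaler_sumr -[RHS]S0; apply: eq_bigr => j _; rewrite cst//.
  by rewrite -ltnS.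
rewrite bspline_piece_partition alg_polyC => /eqP.
by rewrite polyC_eq0 => /eqP a0 j /cst ->.
Qed.

Lemma map_primitive_poly (K L : fieldType) (h : {rmorphism K -> L}) p :
  map_poly h (primitive_poly p) = primitive_poly (map_poly h p).
Proof.
by apply/polyP => i; rewrite coef_map/= !coef_primitive coef_map/= fmorph_div rmorph_nat.
Qed.

Lemma map_bspline_piece (K L : fieldType) (h : {rmorphism K -> L}) M j :
  map_poly h (bspline_piece M j) = bspline_piece M j.
Proof.
elim: M j => [|M IH] [|j] /=; rewrite ?rmorph1 ?rmorph0//.
  by rewrite !addr0 map_primitive_poly IH.
by rewrite rmorphD rmorphB/= !map_primitive_poly !IH map_polyC/= -horner_map/=
  map_primitive_poly IH rmorph1.
Qed.

(** * Values of B-splines on unit intervals *)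

Lemma Rintegral_deriv_poly (R : realType) (p : {poly R}) (a b : R) : a <= b ->
  \int[lebesgue_measure]_(t in `[a, b]) p^`().[t] = p.[b] - p.[a].
Proof.
rewrite le_eqVlt => /predU1P[->|ab].
  by rewrite set_itv1 Rintegral_set1 subrr.
rewrite /Rintegral (@continuous_FTC2 _ _ (horner p))//.
- by apply: continuous_subspaceT => x; exact: continuous_horner.
- split; first by move=> x _; exact: derivable_horner.
  + exact/cvg_at_right_filter/continuous_horner.
  + exact/cvg_at_left_filter/continuous_horner.
- by move=> x _; rewrite derivE.
Qed.

Lemma integrable_poly (R : realType) (p : {poly R}) (a b : R) :
  lebesgue_measure.-integrable `[a, b] (EFin \o horner p).
Proof.
apply: continuous_compact_integrable; first exact: segment_compact.
by apply: continuous_subspaceT => x; exact: continuous_horner.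
Qed.

Lemma integrable_disjointU (d : measure_display) (T : measurableType d)
    (R : realType) (mu : {measure set T -> \bar R}) (A B : set T) (f : T -> \bar R) :
  measurable A -> measurable B -> [disjoint A & B] ->
  mu.-integrable A f -> mu.-integrable B f -> mu.-integrable (A `|` B) f.
Proof.
move=> mA mB AB /integrableP[mAf Af] /integrableP[mBf Bf].
apply/integrableP; rewrite measurable_funU//; split => //.
rewrite ge0_integral_setU//; first exact: lte_add_pinfty.
by apply/measurable_funU => //; split; exact: measurableT_comp.
Qed.

(** Each of the two parts of the integral has a polynomial integrand, whose
    antiderivatives in t are the polynomials F and F' below. *)
Lemma bspline_on_piece (R : realType) M j (x : R) : 0 <= x < 1 ->
  bspline M.+1 (x + j%:R) = (bspline_piece M j).[x].
Proof.
elim: M j x => [|M IH] j x /andP[x0 x1].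
  rewrite /= indicE mem_setE in_itv/=.
  case: j => [|j]; first by rewrite addr0 x0 x1 hornerC.
  rewrite horner0 -natr1 addrA ltNge lerDr andbC.
  by rewrite (addr_ge0 x0 (ler0n _ _)).
have -> : bspline M.+2 (x + j%:R) = \int[lebesgue_measure]_(t in `[0, 1])
    bspline M.+1 (x + j%:R - t) by [].
pose B := bspline_piece M j : {poly R}.
pose B' := (if j is i.+1 then bspline_piece M i else 0) : {poly R}.
pose F : {poly R} := - (primitive_poly B \Po (x%:P - 'X)).
pose F' : {poly R} := - (primitive_poly B' \Po ((x + 1)%:P - 'X)).
have FE t : F^`().[t] = B.[x - t].
  by rewrite derivN deriv_comp deriv_primitive derivB derivC derivX sub0r mulrN1
    opprK horner_comp !hornerE.
have F'E t : F'^`().[t] = B'.[x + 1 - t].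
  by rewrite derivN deriv_comp deriv_primitive derivB derivC derivX sub0r mulrN1
    opprK horner_comp !hornerE.
have E1 t : `[0, x]%classic t -> bspline M.+1 (x + j%:R - t) = F^`().[t].
  move=> tI; have /andP[t0 tx] : 0 <= t <= x by move: tI; rewrite /= in_itv.
  rewrite FE -IH; last by apply/andP; split; lra.
  by congr (bspline _ _); ring.
have E2 t : `]x, 1]%classic t -> bspline M.+1 (x + j%:R - t) = F'^`().[t].
  move=> tI; have /andP[xt t1] : x < t <= 1 by move: tI; rewrite /= in_itv.
  rewrite F'E /B'.
  case: j {B B' F F' FE F'E E1} => [|j].
    by rewrite horner0 bspline_out//; left; rewrite addr0 subr_lt0.
  rewrite -IH; last by apply/andP; split; lra.
  by congr (bspline _ _); rewrite -natr1; ring.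
have I1 : lebesgue_measure.-integrable `[0, x]
    (EFin \o (fun t => bspline M.+1 (x + j%:R - t))).
  apply: eq_integrable (integrable_poly _ F^`() 0 x) => // t.
  by rewrite inE => tx; congr EFin; symmetry; exact: E1.
have I2 : lebesgue_measure.-integrable `]x, 1]
    (EFin \o (fun t => bspline M.+1 (x + j%:R - t))).
  have IF' : lebesgue_measure.-integrable `]x, 1] (EFin \o horner F'^`()).
    by apply: integrableS (integrable_poly _ F'^`() x 1) => //; by apply: subset_itvr; rewrite bnd_simp.
  apply: eq_integrable IF' => // t.
  by rewrite inE => tx; congr EFin; symmetry; exact: E2.
have J1 : \int[lebesgue_measure]_(t in `[0, x]) bspline M.+1 (x + j%:R - t) =
    \int[lebesgue_measure]_(t in `[0, x]) F^`().[t].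
  by apply: eq_Rintegral => t; rewrite inE => /E1.
have J2 : \int[lebesgue_measure]_(t in `]x, 1]) bspline M.+1 (x + j%:R - t) =
    \int[lebesgue_measure]_(t in `]x, 1]) F'^`().[t].
  by apply: eq_Rintegral => t; rewrite inE => /E2.
rewrite (@itv_bndbnd_setU _ _ _ (BRight x)) ?bnd_simp ?(ltW x1)//.
have dis : [disjoint `[0%R, x] & `]x, 1%R]].
  apply/disj_setPS => y [/=]; rewrite 2!in_itv/= => /andP[_ yx] /andP[].
  by rewrite ltNge yx.
rewrite Rintegral_setU//; last exact: integrable_disjointU.
rewrite J1 J2.
rewrite Rintegral_itv_obnd_cbnd; last first.
  apply: integrableS (integrable_poly _ F'^`() x 1) => //.
  by apply: subset_itvr; rewrite bnd_simp.
have FV t : F.[t] = - (primitive_poly B).[x - t].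
  by rewrite hornerN horner_comp !hornerE.
have F'V t : F'.[t] = - (primitive_poly B').[x + 1 - t].
  by rewrite hornerN horner_comp !hornerE.
rewrite !Rintegral_deriv_poly ?(ltW x1)// !FV !F'V.
have -> : x + 1 - x = 1 by ring.
rewrite addrK subrr subr0 primitive_poly_at0 oppr0 add0r !opprK.
case: j @B @B' {F F' FE F'E E1 E2 I1 I2 J1 J2 FV F'V} => [|j] /=.
  by rewrite primitive_poly0 !horner0 oppr0 !addr0.
by rewrite !hornerD hornerN hornerC [- _ + _]addrC.
Qed.

(** * Splines on a unit interval and local phase retrieval *)

(** The polynomial that agrees with the spline with coefficients c on
    [[k, k+1)], in the variable x - k. *)
Definition window_poly {K : fieldType} (M : nat) (c : int -> K) (k : int) : {poly K} :=
  \sum_(j < M.+1) c (k - j%:Z) *: bspline_piece M j.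

Lemma size_window_poly (K : fieldType) M (c : int -> K) k :
  (size (window_poly M c k) <= M.+1)%N.
Proof.
apply: (leq_trans (size_sum _ _ _)); apply/bigmax_leqP => j _.
exact: leq_trans (size_scale_leq _ _) (size_bspline_piece _ _ _).
Qed.

Lemma window_poly_inj (K : numFieldType) M (c d : int -> K) k :
  window_poly M c k = window_poly M d k ->
  forall l, k - M.+1%:Z < l <= k -> c l = d l.
Proof.
move/eqP; rewrite -subr_eq0 -sumrB => /eqP S l lk.
have -> : l = k - `|k - l|%N%:Z by lia.
apply/eqP; rewrite -subr_eq0; apply/eqP.
apply: (@bspline_piece_free _ M (fun j => c (k - j%:Z) - d (k - j%:Z))); last by lia.
by rewrite -[RHS]S; apply: eq_bigr => i _; rewrite scalerBl.
Qed.

Lemma window_polyZ (K : fieldType) M (c : int -> K) k z :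
  z *: window_poly M c k = window_poly M (fun l => z * c l) k.
Proof. by rewrite scaler_sumr; apply: eq_bigr => j _; rewrite scalerA. Qed.

Lemma map_window_poly (K L : fieldType) (h : {rmorphism K -> L}) M (c : int -> K) k :
  map_poly h (window_poly M c k) = window_poly M (h \o c) k.
Proof.
rewrite rmorph_sum/=; apply: eq_bigr => j _.
by rewrite map_polyZ/= map_bspline_piece.
Qed.

Section Local.
Context {R : realType}.
Implicit Types (c d : int -> R[i]) (k : int).

Lemma spline_window M c k (x : R) : 0 <= x < 1 ->
  spline M.+1 c (x + k%:~R) = (window_poly M c k).[x%:C%C].
Proof.
move=> x01; rewrite /spline /spline_on.
rewrite -(@fsbig_widen _ _ _ _ [set k - j%:Z | j in `I_M.+1])//; last first.
  move=> l [_ nl]; rewrite /preimage/mkset.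
  suff -> : bspline M.+1 (x + k%:~R - l%:~R) = 0 by rewrite mulr0.
  apply: bspline_out; have [kl|lk] := ltP k l.
    left; rewrite -addrA -intrB; have : (k - l)%:~R <= (-1)%:~R :> R by rewrite ler_int; lia.
    by case/andP: x01 => *; lra.
  right; have hM : (M.+1%:Z <= k - l).
    rewrite leNgt; apply/negP => h; apply: nl; exists `|k - l|%N; rewrite /=; lia.
  rewrite -addrA -intrB; have : M.+1%:R <= (k - l)%:~R :> R by rewrite pmulrn ler_int.
  by case/andP: x01 => *; lra.
rewrite fsbig_image; last by move=> i j _ _ /=; lia.
rewrite -fsbig_ord /window_poly horner_sum; apply: eq_bigr => j _.
rewrite hornerZ; congr (_ * _).
rewrite (_ : x + k%:~R - (k - j%:Z)%:~R = x + j%:R); last by rewrite intrB; ring.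
by rewrite bspline_on_piece// -(map_bspline_piece _ _ (real_complex R)) horner_map.
Qed.

(** [cderive] is defined through real and imaginary parts, so these are needed as
    real polynomials. *)
Lemma window_poly_ReIm M c k (x : R) :
  (window_poly M c k).[x%:C%C] =
  ((window_poly M (fun l => complex.Re (c l)) k).[x] +i*
   (window_poly M (fun l => complex.Im (c l)) k).[x])%C.
Proof.
rewrite /window_poly !horner_sum.
elim/big_ind3: _ => [//|a p q a' p' q' -> ->//|j _].
rewrite !hornerZ -(map_bspline_piece _ _ (real_complex R)) horner_map/=.
by case: (c _) => a b /=; simpc.
Qed.

Lemma derive1_window (F : R -> R) (p : {poly R}) (x k : R) : 0 < x < 1 ->
  (forall y, 0 <= y < 1 -> F (y + k) = p.[y]) -> derive1 F (x + k) = p^`().[x].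
Proof.
move=> /andP[x0 x1] FE; rewrite derive1E.
have -> : 'D_1 F (x + k) = 'D_1 (horner (p \Po ('X - k%:P))) (x + k).
  apply: near_eq_derive; near=> y.
  have : y \in `]k, (1 + k)[ by near: y; apply: near_in_itvoo; rewrite in_itv/=; lra.
  rewrite in_itv/= => /andP[ky yk].
  by rewrite horner_comp !hornerE -FE ?subrK//; lra.
rewrite -derive1E -derivE deriv_comp derivB derivX derivC subr0 mulr1.
by rewrite horner_comp !hornerE addrK.
Unshelve. all: by end_near. Qed.

Lemma cderive_spline_window M c k (x : R) : 0 < x < 1 ->
  cderive (spline M.+1 c) (x + k%:~R) = (window_poly M c k)^`().[x%:C%C].
Proof.
move=> x01; rewrite /cderive.
rewrite (@derive1_window _ (window_poly M (fun l => complex.Re (c l)) k))//; last first.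
  by move=> y y01; rewrite spline_window// window_poly_ReIm.
rewrite (@derive1_window _ (window_poly M (fun l => complex.Im (c l)) k))//; last first.
  by move=> y y01; rewrite spline_window// window_poly_ReIm.
rewrite /window_poly !raddf_sum !horner_sum.
elim/big_ind3: _ => [//|a p q a' p' q' <- <-//|j _].
rewrite /= !derivZ !hornerZ -(map_bspline_piece _ _ (real_complex R)) deriv_map horner_map/=.
by case: (c _) => a b /=; simpc.
Qed.

Local Notation conjp := (map_poly (@conjc R)).

Lemma horner_conjp (p : {poly R[i]}) (x : R) :
  (conjp p).[x%:C%C] = (p.[x%:C%C])^*%C.
Proof. by rewrite -[in LHS](conjc_real x) horner_map. Qed.

(** At a real point the conjugate polynomial takes the conjugate value, so the
    squared modulus of p is the value of the polynomial p times its
    conjugate. *)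
Lemma eq_norm_conjp (p q : {poly R[i]}) (x : R) :
  `|q.[x%:C%C]| = `|p.[x%:C%C]| ->
  (p * conjp p).[x%:C%C] = (q * conjp q).[x%:C%C].
Proof.
move=> e; rewrite !hornerM !horner_conjp.
by have := normCK p.[x%:C%C]; rewrite -e normCK.
Qed.

Lemma eq_poly_real_points (A : {fset R}) (p q : {poly R[i]}) :
  (size (p - q)%R <= #|` A|)%N ->
  (forall x, x \in A -> p.[x%:C%C] = q.[x%:C%C]) -> p = q.
Proof.
move=> s e; apply/eqP; rewrite -subr_eq0; apply/eqP.
apply: (@roots_poly0 _ _ [seq x%:C%C | x <- A]).
- by rewrite map_inj_uniq ?fset_uniq//; exact: (fmorph_inj (real_complex R)).
- by move=> _ /mapP[x /e xA ->]; rewrite rootE !hornerE/= xA subrr.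
- by rewrite size_map.
Qed.

(** Here N = n+3, and the cardinals are 2N-1 and 2N-5.  The points are exactly as
    many as the sizes allow: p times its conjugate has size at most 2N-1, and
    [size_derivM_diff] bounds the other difference by 2N-5. *)
Lemma phase_retrieval_real (n : nat) (A A' : {fset R}) (p q : {poly R[i]}) :
  (size p <= n.+3)%N -> (size q <= n.+3)%N ->
  #|` A| = (2 * n + 5)%N -> #|` A'| = (2 * n + 1)%N ->
  (forall x, x \in A -> `|q.[x%:C%C]| = `|p.[x%:C%C]|) ->
  (forall x, x \in A' -> `|(q^`()).[x%:C%C]| = `|(p^`()).[x%:C%C]|) ->
  exists2 z, `|z| = 1 & q = z *: p \/ q = z *: conjp p.
Proof.
move=> sp sq cA cA' hA hA'.
have sc (r : {poly R[i]}) : size (conjp r) = size r by rewrite size_map_poly.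
have e : p * conjp p = q * conjp q.
  apply: (@eq_poly_real_points A); last by move=> x /hA /eq_norm_conjp.
  have sM (r : {poly R[i]}) : (size r <= n.+3)%N -> (size (r * conjp r)%R <= 2 * n + 5)%N.
    move=> sr; apply: leq_trans (size_polyMleq _ _) _.
    by rewrite sc; move: sr; clear; lia.
  rewrite cA (leq_trans (size_polyD _ _))// geq_max sM//= size_polyN sM//.
have e' : p^`() * (conjp p)^`() = q^`() * (conjp q)^`().
  rewrite !deriv_map.
  apply: (@eq_poly_real_points A'); last by move=> x /hA' /eq_norm_conjp.
  rewrite -!deriv_map cA' (leq_trans (@size_derivM_diff _ _ _ _ _ n _ _ _ _ e)) ?sc//.
  by clear; lia.
have [p0|p0] := eqVneq p 0.
  move: e; rewrite p0 mul0r => /esym/eqP; rewrite mulf_eq0 map_poly_eq0 orbb => /eqP ->.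
  by exists 1; [rewrite normr1|left; rewrite scaler0].
have cp0 : conjp p != 0 by rewrite map_poly_eq0.
have [z hz] := phase_retrieval_poly _ _ _ _ _ e e' p0 cp0.
exists z => //.
(* Comparing q qbar with p pbar shows that z has modulus 1. *)
have eN : (z * z^*%C) *: (p * conjp p) = p * conjp p.
  rewrite [RHS]e; case: hz => ->; rewrite map_polyZ/= -scalerAl -scalerAr scalerA//.
  have -> : conjp (conjp p) = p by apply/polyP => i; rewrite !coef_map/= conjcK.
  by rewrite [p * _]mulrC.
have : z * z^*%C = 1.
  apply/eqP; rewrite -subr_eq0 -polyC_eq0.
  rewrite -(inj_eq (mulIf (mulf_neq0 p0 cp0))) mul0r mul_polyC scalerBl eN scale1r.
  by rewrite subrr.
move=> zz; apply/eqP; rewrite -(@pexpr_eq1 _ _ 2)//.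
by rewrite normCK; apply/eqP.
Qed.
End Local.

(** * Gluing the windows *)

Lemma int_chain (P : int -> Prop) (a b : int) : a <= b -> P a ->
  (forall k, a <= k < b -> P k -> P (k + 1)) -> P b.
Proof.
move=> ab Pa step.
have : forall n : nat, a + n%:Z <= b -> P (a + n%:Z).
  elim=> [_|n IH nb]; first by rewrite addr0.
  have -> : a + n.+1%:Z = a + n%:Z + 1 by lia.
  by apply: step; [lia|apply: IH; lia].
by move=> /(_ `|b - a|%N); rewrite (_ : a + _ = b); [apply; rewrite lexx|lia].
Qed.

Section Alignment.
Context {R : realType}.
Implicit Types (z w xi : R[i]).

Lemma conjcM_sym z w : complex.Im (z * w^*%C) = 0 -> z * w^*%C = z^*%C * w.
Proof.
case: z w => x y [u v] /=; simpc => h.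
by congr (_ +i* _)%C; lra.
Qed.

(** Im(xi^* z) = 0 says that z lies on the real line spanned by xi, and a nonzero
    z spans the same line. *)
Lemma Im_conjM_trans xi z w : z != 0 -> complex.Im (xi^*%C * z) = 0 ->
  complex.Im (z * w^*%C) = 0 -> complex.Im (xi^*%C * w) = 0.
Proof.
case: xi z w => a b [x y] [u v]; rewrite eq_complex negb_and /= => nz h1 h2.
case/orP: nz => nz; apply: (mulfI nz); rewrite mulr0.
  transitivity (u * (a * y + - b * x) - a * (x * - v + y * u)); last by rewrite h1 h2; ring.
  by ring.
transitivity (v * (a * y + - b * x) - b * (x * - v + y * u)); last by rewrite h1 h2; ring.
by ring.
Qed.

Lemma Im_mulC_real xi z w : xi != 0 -> complex.Im (xi^*%C * z) = 0 ->
  complex.Im (xi^*%C * w) = 0 -> complex.Im (z * w^*%C) = 0.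
Proof.
case: xi z w => a b [x y] [u v]; rewrite eq_complex negb_and /= => nz h1 h2.
case/orP: nz => nz; apply: (mulfI nz); rewrite mulr0.
  transitivity (u * (a * y + - b * x) - x * (a * v + - b * u)); last by rewrite h1 h2; ring.
  by ring.
transitivity (v * (a * y + - b * x) - y * (a * v + - b * u)); last by rewrite h1 h2; ring.
by ring.
Qed.

Lemma norm_conjc z : `|z^*%C| = `|z|.
Proof. exact: norm_conjC. Qed.
End Alignment.

Section Gluing.
Context {R : realType}.
Variable N : nat.
Implicit Types (c d : int -> R[i]) (k l : int) (A : set int).

(** The indices of the B-splines that are nonzero on [[k, k+1)]. *)
Definition window k : set int := [set l | k - N%:Z < l <= k].
Definition overlap k : set int := window k `&` window (k + 1).

(** The values of c on A lie on one real line through the origin. *)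
Definition aligned c A := forall l m, A l -> A m -> complex.Im (c l * (c m)^*%C) = 0.
Definition vanishes c A := forall l, A l -> c l = 0.
Definition unimodular_multiple c d A :=
  exists2 z, `|z| = 1 & forall l, A l -> d l = z * c l.

Local Notation conj c := (fun l => (c l)^*%C).

Lemma aligned_conj c A : aligned c A -> aligned (conj c) A.
Proof.
move=> al l m Al Am; have := al l m Al Am.
case: (c l) (c m) => x y [u v] /=; lra.
Qed.

(** Conjugation acts on a real line through the origin as multiplication by a
    unimodular constant, namely c_l / c_l^* for any nonzero c_l on the line. *)
Lemma aligned_multiple_conj c d A : aligned c A -> unimodular_multiple c d A ->
  unimodular_multiple (conj c) d A.
Proof.
move=> al [z z1 dE].
have [[l [Al cl]]|none] := pselect (exists l, A l /\ c l != 0); last first.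
  exists 1; first exact: normr1.
  move=> l Al; have -> : c l = 0.
    by apply/eqP/negPn/negP => cl; apply: none; exists l.
  rewrite conjc0 mulr0 dE//; have [->|cl] := eqVneq (c l) 0; first by rewrite mulr0.
  by exfalso; apply: none; exists l.
have cl' : (c l)^*%C != 0 by rewrite conjc_eq0.
exists (z * (c l / (c l)^*%C)).
  by rewrite normrM z1 mul1r normf_div norm_conjc divff// normr_eq0.
move=> m Am; rewrite dE// -!mulrA; congr (_ * _).
apply: (mulIf cl'); rewrite [_^-1 * _]mulrC mulrA mulfVK//.
rewrite conjcM_sym; first exact: mulrC.
exact: al.
Qed.

(** The products d_l d_m^* equal both c_l c_m^* and its conjugate. *)
Lemma multiple_both_aligned c d A :
  unimodular_multiple c d A -> unimodular_multiple (conj c) d A ->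
  aligned c A.
Proof.
move=> [z z1 dE] [z' z'1 d'E] l m Al Am.
have unit (u v w : R[i]) : `|u| = 1 -> u * v * (u * w)^*%C = v * w^*%C.
  move=> u1; rewrite rmorphM/= mulrACA.
  by have := normCK u; rewrite u1 expr1n => <-; rewrite mul1r.
have := unit z (c l) (c m) z1; rewrite -!dE// !d'E// unit// conjcK.
move/(congr1 (@complex.Im R)); case: (c l) (c m) => x y [u v] /=; lra.
Qed.

Lemma multiple_step c d a b : a <= b -> unimodular_multiple c d (window a) ->
  (forall k, unimodular_multiple c d (window k) \/
             unimodular_multiple (conj c) d (window k)) ->
  (forall k, a <= k < b -> ~ aligned c (overlap k)) -> unimodular_multiple c d (window b).
Proof.
move=> ab ma either nal.
apply: (int_chain (fun k => unimodular_multiple c d (window k)) _ _ ab ma).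
move=> k kab mk.
have [//|mk1] := either (k + 1); case: (nal k kab).
apply: (@multiple_both_aligned _ d).
  by case: mk => z z1 dE; exists z => // l [wl _]; exact: dE.
by case: mk1 => z z1 dE; exists z => // l [_ wl]; exact: dE.
Qed.

(** A window b on which c fails and a window a on which its conjugate fails are
    both unaligned, so no overlap between them is aligned, and the alternative
    valid at the left one of the two propagates to the right one. *)
Lemma global_alternative c d :
  (forall k, unimodular_multiple c d (window k) \/
             unimodular_multiple (conj c) d (window k)) ->
  (forall k, aligned c (overlap k) ->
    (forall j, j <= k -> aligned c (window j)) \/
    (forall j, k < j -> aligned c (window j))) ->
  (forall k, unimodular_multiple c d (window k)) \/
  (forall k, unimodular_multiple (conj c) d (window k)).
Proof.
move=> either split.
have conjK : conj (conj c) = c by apply/funext => l; rewrite conjcK.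
apply: contrapT => /not_orP[/existsNP[b nb] /existsNP[a na]].
have mb : unimodular_multiple (conj c) d (window b) by case: (either b).
have ma : unimodular_multiple c d (window a) by case: (either a).
have alb : ~ aligned c (window b).
  move=> al; apply: nb; rewrite -conjK.
  by apply: aligned_multiple_conj => //; exact: aligned_conj.
have ala : ~ aligned c (window a).
  by move=> al; apply: na; exact: aligned_multiple_conj.
have nal k : Num.min a b <= k < Num.max a b -> ~ aligned c (overlap k).
  move=> kab /split[] al.
    by have [ab|ba] := leP a b; [apply/ala/al|apply/alb/al]; lia.
  by have [ab|ba] := leP a b; [apply/alb/al|apply/ala/al]; lia.
have [ab|ba] := leP a b.
  by apply/nb/(multiple_step _ _ _ _ ab ma either) => k kab; apply: nal; lia.
apply/na/(multiple_step _ _ _ _ (ltW ba) mb) => k; first by rewrite conjK or_comm.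
move=> kab /aligned_conj; rewrite conjK; apply: nal; lia.
Qed.

(** Between two indices with nonzero coefficients no overlap vanishes, so the
    constant of the first one propagates to the second one. *)
Lemma global_phase c d : (0 < N)%N ->
  (forall k, unimodular_multiple c d (window k)) ->
  (forall k, vanishes c (overlap k) ->
    (forall j, j <= k -> vanishes c (window j)) \/
    (forall j, k < j -> vanishes c (window j))) ->
  unimodular_multiple c d setT.
Proof.
move=> N0 mul split.
have win l : window l l by rewrite /window/=; lia.
have chain a b z : a <= b -> c a != 0 -> c b != 0 ->
    (forall l, window a l -> d l = z * c l) -> d b = z * c b.
  move=> ab ca cb da.
  suff db : forall l, window b l -> d l = z * c l by exact: db.
  apply: (int_chain (fun k => forall l, window k l -> d l = z * c l) _ _ ab da).
  move=> k kab dk; have [m om cm] : exists2 m, overlap k m & c m != 0.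
    apply: contrapT => none; case: (split k).
    - move=> l ol; apply/eqP/negPn/negP => cl; apply: none; exists l => //.
    - by move=> /(_ a) v; move: ca; rewrite v ?eqxx//; lia.
    - by move=> /(_ b) v; move: cb; rewrite v ?eqxx//; lia.
  have [z' _ dk1] := mul (k + 1); case: om => wm wm1.
  suff -> : z = z' by [].
  by apply: (mulIf cm); rewrite -dk// -dk1.
have [[a ca]|none] := pselect (exists a, c a != 0); last first.
  exists 1; first exact: normr1.
  move=> l _; have [z _ dl] := mul l; rewrite dl//.
  have -> : c l = 0 by apply/eqP/negPn/negP => cl; apply: none; exists l.
  by rewrite !mulr0.
have [z z1 da] := mul a; exists z => // b _.
have [z' z'1 db] := mul b.
have [cb|cb] := eqVneq (c b) 0; first by rewrite db// cb !mulr0.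
have [ab|ba] := leP a b; first exact: chain ab ca cb da.
have := chain b a z' (ltW ba) cb ca db; rewrite da// => /(mulIf ca) ->.
exact: db.
Qed.
End Gluing.

(** * The decomposition and the overlaps *)

Section Kappa.
Context {R : realType}.
Implicit Types (c : int -> R[i]) (xi : R[i]) (k l : int).

Lemma eintD k l : (eint (k + l) = eint k + eint l :> \bar R)%E.
Proof. by rewrite /eint intrD EFinD. Qed.

Lemma eint_nat (n : nat) : (eint n%:Z = n%:R%:E :> \bar R)%E.
Proof. by rewrite /eint -pmulrn. Qed.

Definition real_below c xi k := forall l, l <= k -> complex.Im (xi^*%C * c l) = 0.
Definition real_above c xi k := forall l, k <= l -> complex.Im (xi^*%C * c l) = 0.

Lemma kappa_minus_le c xi k : ~ real_below c xi k ->
  (kappa_minus c xi <= eint (k - 1))%E.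
Proof.
move=> nk; apply: ge_ereal_sup => _ [j /= hj <-]; rewrite le_eint.
suff : ~ k <= j by lia.
by move=> kj; apply: nk => l lk; apply: hj; lia.
Qed.

Lemma kappa_minus_lt c xi k : ~ real_below c xi k -> (kappa_minus c xi < eint k)%E.
Proof. by move=> /kappa_minus_le h; apply: (le_lt_trans h); rewrite lt_eint; lia. Qed.

Lemma real_below_ge c xi k : real_below c xi k -> (eint k <= kappa_minus c xi)%E.
Proof. by move=> h; apply: ereal_sup_ubound; exists k. Qed.

Lemma kappa_plus_ge c xi1 xi2 k :
  (forall j, ~ real_below c xi1 j -> real_above c xi2 j -> k <= j) ->
  (eint k <= kappa_plus c xi1 xi2)%E.
Proof.
move=> h; apply: le_ereal_inf_tmp => _ [j /= [kj hj] <-]; rewrite le_eint.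
by apply: h => // /real_below_ge; rewrite leNgt kj.
Qed.

(** If c has a last nonzero coefficient, a phase adapted to that coefficient is a
    competitor for xi2, and optimality bounds [kappa_plus]; otherwise [Kplus] is
    infinite. *)
Lemma kappa_plus_le_Kplus c xi1 xi2 m : optimal_phases c xi1 xi2 ->
  ~ real_below c xi1 m -> (kappa_plus c xi1 xi2 <= Kplus c)%E.
Proof.
move=> [_ _ _ opt] nm.
have [[k hk]|unb] := pselect (exists k, forall l, k <= l -> c l = 0).
  have [[p cp]|none] := pselect (exists p, c p != 0); last first.
    exfalso; apply: nm => l _; have -> : c l = 0.
      by apply/eqP/negPn/negP => cl; apply: none; exists l.
    by rewrite mulr0.
  have [j cj hj] := last_nonzero hk cp; have [xi nxi hxi] := exists_phase (c j).
  apply: (le_trans (opt _ nxi)); apply: (@le_trans _ _ (eint j)); last first.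
    by apply: ereal_sup_ubound; exists j.
  apply: ereal_inf_lbound; exists j => //=; split.
    apply: kappa_minus_lt => bj; apply: nm => l _.
    by have [/bj//|/hj ->] := leP l j; rewrite mulr0.
  by move=> l; rewrite le_eqVlt => /orP[/eqP<-//|/hj ->]; rewrite mulr0.
suff -> : Kplus c = +oo%E by rewrite leey.
apply/eqyP => A _; have [l lA cl] : exists2 l, Num.ceil A <= l & c l != 0.
  apply: contrapT => none; apply: unb; exists (Num.ceil A) => l Al.
  by apply/eqP/negPn/negP => cl; apply: none; exists l.
apply: (@le_trans _ _ (eint l)); last by apply: ereal_sup_ubound; exists l.
by rewrite /eint lee_fin (le_trans (@ceil_ge _ A))// ler_int.
Qed.

Lemma int_minimal (P : int -> Prop) (a b : int) : P b -> (forall j, P j -> a <= j) ->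
  exists2 j, P j & forall i, P i -> j <= i.
Proof.
move=> Pb Pa.
have ex : exists n : nat, `[< P (a + n%:Z) >].
  exists `|b - a|%N; apply/asboolP; have := Pa _ Pb => ab.
  by rewrite (_ : a + _ = b) //; lia.
case: (ex_minnP ex) => n /asboolP Pn mn; exists (a + n%:Z) => // i Pi.
have ai := Pa _ Pi; have := mn `|i - a|%N.
by rewrite (_ : a + _ = i); [move=> /(_ (asboolT Pi)); lia|lia].
Qed.

Lemma Kset_nonempty c xi1 xi2 x : optimal_phases c xi1 xi2 ->
  ~ real_below c xi1 x ->
  (forall j, ~ real_below c xi1 j -> real_above c xi2 j -> x + 1 <= j) ->
  Kset c xi1 xi2 !=set0.
Proof.
move=> opt nx hx; exists x; have kp := kappa_plus_ge _ _ _ _ hx.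
split; last exact: kappa_plus_le_Kplus opt nx.
  by rewrite kappa_minus_lt//= (lt_le_trans _ kp)// lt_eint; lia.
apply: (le_trans _ kp); rewrite (_ : x + 1 = x - 1 + 2); last by lia.
by rewrite eintD eint_nat leeD2r// kappa_minus_le.
Qed.

(** Left of [kappa_minus] and right of [kappa_plus] the coefficients lie on the
    lines of xi1 and xi2.  An overlap inside one of these ranges settles one of
    its sides.  The other overlaps are those covered by (ii), which excludes
    alignment, unless the line of xi2 takes over from that of xi1 with no
    coefficient in between; [Kset] is then empty and (ii) gives nothing. *)
Lemma aligned_overlap_split (N : nat) c xi1 xi2 :
  optimal_phases c xi1 xi2 ->
  (Kset c xi1 xi2 !=set0 -> forall k : int,
    (kappa_minus c xi1 + 1%:E <= eint k)%E ->
    (eint k <= kappa_plus c xi1 xi2 + N%:R%:E - 3%:E)%E ->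
    \sum_(n1 \in [set n : int | k - N%:Z + 2 <= n <= k])
      \sum_(n2 \in [set n : int | n1 < n <= k])
        `|complex.Im (c n1 * (c n2)^*%C)| <> 0) ->
  forall k, aligned c (overlap N k) ->
    (forall j, j <= k -> aligned c (window N j)) \/
    (forall j, k < j -> aligned c (window N j)).
Proof.
move=> opt cond k al; have [n1 n2 _ _] := opt.
have nz xi : `|xi| = 1 -> xi != 0 by move=> h; rewrite -normr_eq0 h oner_eq0.
have [below|nbelow] := pselect (real_below c xi1 k).
  left=> j jk l m; rewrite /window/= => wl wm.
  by apply: (Im_mulC_real xi1); [exact: nz|apply: below; lia|apply: below; lia].
have [above|nabove] := pselect (real_above c xi2 (k - N%:Z + 2)).
  right=> j jk l m; rewrite /window/= => wl wm.
  by apply: (Im_mulC_real xi2); [exact: nz|apply: above; lia|apply: above; lia].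
(* Transition without a middle part: xi1-real up to m, xi2-real from m+1 on, and
   c_{m+1} is not xi1-real.  An aligned overlap containing m and m+1 then vanishes
   up to m, so only xi2-real coefficients remain on the right. *)
have [[m [bm nbm am]]|nom] := pselect (exists m,
    [/\ real_below c xi1 m, ~ real_below c xi1 (m + 1) & real_above c xi2 (m + 1)]).
  right=> j kj; have mk : m < k.
    by rewrite ltNge; apply/negP => km; apply: nbelow => l lk; apply: bm; lia.
  have km : k - N%:Z + 2 <= m.
    by rewrite leNgt; apply/negP => mk'; apply: nabove => l lk; apply: am; lia.
  have z0 l : window N j l -> l <= m -> c l = 0.
    rewrite /window/= => wl lm; apply/eqP/negPn/negP => cl; apply: nbm => i im.
    have [/bm//|mi] := leP i m; have -> : i = m + 1 by lia.
    apply: (Im_conjM_trans _ (c l)) => //; first exact: bm.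
    by apply: al; split; rewrite /window/=; lia.
  move=> l i wl wi.
  have [lm|ml] := leP l m; first by rewrite z0// mul0r.
  have [im|mi] := leP i m; first by rewrite [c i]z0// conjc0 mulr0.
  by apply: (Im_mulC_real xi2); [exact: nz|apply: am; lia|apply: am; lia].
(* In the remaining case a middle index x exists: k itself if [kappa_plus] is
   infinite, the index just before [kappa_plus] otherwise. *)
exfalso; have ge j : real_above c xi2 j -> k - N%:Z + 3 <= j.
  move=> aj; rewrite leNgt; apply/negP => jk; apply: nabove => l lk; apply: aj; lia.
have [x nx hx] : exists2 x, ~ real_below c xi1 x &
    forall j, ~ real_below c xi1 j -> real_above c xi2 j -> x + 1 <= j.
  have [[p [np ap]]|none] :=
      pselect (exists j, ~ real_below c xi1 j /\ real_above c xi2 j); last first.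
    by exists k => // j nj aj; exfalso; apply: none; exists j.
  have [||j [nj aj] minj] := int_minimal
      (fun j => ~ real_below c xi1 j /\ real_above c xi2 j) (k - N%:Z + 3) p.
  - by split.
  - by move=> j [_ /ge].
  exists (j - 1); last by move=> i ni ai; rewrite subrK; apply: minj.
  by move=> bj; apply: nom; exists (j - 1); rewrite subrK.
apply: (cond (Kset_nonempty _ _ _ _ opt nx hx) k).
- have -> : k = k - 1 + 1 by lia.
  by rewrite eintD eint_nat leeD2r// kappa_minus_le.
- have -> : eint k = (eint (k - N%:Z + 3) + N%:R%:E - 3%:E :> \bar R)%E.
    transitivity (((k - N%:Z + 3)%:~R + N%:R - 3)%:E : \bar R); last by [].
    by rewrite /eint; congr EFin; rewrite intrD intrB -pmulrn; ring.
  by rewrite leeD2r// leeD2r// kappa_plus_ge// => j _ /ge.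
- rewrite fsbig1// => i /= ik; rewrite fsbig1// => j /= ij.
  by rewrite al ?normr0//; split; rewrite /window/=; lia.
Qed.

(** The overlap at k is a block of N-1 consecutive coefficients starting at
    k-N+2.  By (i) a block of zeros ends before the first nonzero coefficient of
    c or starts after the last one. *)
Lemma vanishing_overlap_split (N : nat) c : (0 < N)%N ->
  (forall k : int, (Kminus c - N%:R%:E + 1%:E < eint k < Kplus c + 1%:E)%E ->
    \sum_(l < N.-1) `|c (k + (l : nat)%:Z)| <> 0) ->
  forall k, vanishes c (overlap N k) ->
    (forall j, j <= k -> vanishes c (window N j)) \/
    (forall j, k < j -> vanishes c (window N j)).
Proof.
move=> N0 cond k v.
have zero l : (c l != 0 -> False) -> c l = 0.
  by move=> h; apply/eqP/negPn/negP.
pose q := k - N%:Z + 2.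
have : ~ (Kminus c - N%:R%:E + 1%:E < eint q < Kplus c + 1%:E)%E.
  move=> /cond; apply; rewrite big1// => l _; rewrite v ?normr0//.
  by have := ltn_ord l; split; rewrite /window/= /q; lia.
move=> /negP; rewrite negb_and -!leNgt => /orP[h|h]; [left|right] => j jk l.
  rewrite /window/= => wl; apply: zero => cl.
  have : (Kminus c <= eint l)%E by apply: ereal_inf_lbound; exists l.
  move=> /(leeD2r (- N%:R%:E)%E) /(leeD2r 1%:E) /(le_trans h).
  rewrite (_ : (_ + _)%E = eint (l - N%:Z + 1)); first by rewrite le_eint /q; lia.
  by rewrite /eint -EFinB -EFinD; congr EFin; rewrite intrD intrB -pmulrn.
rewrite /window/= => wl; apply: zero => cl.
have : (eint l <= Kplus c)%E by apply: ereal_sup_ubound; exists l.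
move=> /(leeD2r 1%:E) /le_trans/(_ h).
have <- : eint (l + 1) = (eint l + 1%:E)%E :> \bar R by rewrite eintD.
by rewrite le_eint /q; lia.
Qed.
End Kappa.

(** * Recovery of the spline *)

(** Linear independence of the pieces turns q = z p into a relation between the
    coefficients. *)
Lemma window_dichotomy (R : realType) (n : nat) (A A' : {fset R}) (c d : int -> R[i]) :
  (forall x : R, x \in A -> 0 < x < 1) -> (forall x : R, x \in A' -> 0 < x < 1) ->
  #|` A| = (2 * n.+3 - 1)%N -> #|` A'| = (2 * n.+3 - 5)%N ->
  (forall (x : R) (k : int), x \in A ->
    `|spline n.+3 d (x + k%:~R)| = `|spline n.+3 c (x + k%:~R)|) ->
  (forall (x : R) (k : int), x \in A' ->
    `|cderive (spline n.+3 d) (x + k%:~R)| = `|cderive (spline n.+3 c) (x + k%:~R)|) ->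
  forall k, unimodular_multiple c d (window n.+3 k) \/
            unimodular_multiple (fun l => (c l)^*%C) d (window n.+3 k).
Proof.
move=> hA hA' cA cA' sA sA' k.
have [||||||z z1 qE] := @phase_retrieval_real R n A A'
    (window_poly n.+2 c k) (window_poly n.+2 d k).
- exact: size_window_poly.
- exact: size_window_poly.
- by rewrite cA; lia.
- by rewrite cA'; lia.
- move=> x xA; have /andP[/ltW x0 x1] := hA _ xA.
  by have := sA x k xA; rewrite !spline_window// x0.
- by move=> x xA; have := sA' x k xA; rewrite !cderive_spline_window// hA'.
case: qE => qE; [left|right]; exists z => //; apply: window_poly_inj.
  by rewrite qE window_polyZ.
by rewrite qE (map_window_poly _ _ (@conjc R)) window_polyZ.
Qed.

Lemma splineZ (R : realType) (N : nat) (z : R[i]) (c d : int -> R[i]) (x : R) :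
  (forall l, d l = z * c l) -> spline N d x = z * spline N c x.
Proof.
move=> dE; rewrite /spline !spline_onE !fsbig_finite ?big_distrr/=; try exact: bspline_finite.
by apply: eq_bigr => k _; rewrite in_setT dE mulrA.
Qed.

Lemma spline_conj (R : realType) (N : nat) (c : int -> R[i]) (x : R) :
  spline N (fun l => (c l)^*%C) x = (spline N c x)^*%C.
Proof.
rewrite /spline !spline_onE !fsbig_finite; try exact: bspline_finite.
rewrite rmorph_sum/=; apply: eq_bigr => k _.
rewrite in_setT [RHS]rmorphM; congr (_ * _); exact/esym/conjc_real.
Qed.

Theorem theorem4p1 (R : realType) (N : nat) (hN : (3 <= N)%N)
  (Gamma Gamma' : {fset R})
  (hGamma : forall x : R, x \in Gamma -> 0 < x < 1)
  (hGamma' : forall x : R, x \in Gamma' -> 0 < x < 1)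
  (cardGamma : #|` Gamma| = (2 * N - 1)%N)
  (cardGamma' : #|` Gamma'| = (2 * N - 5)%N)
  (c : int -> R[i]) (f : R -> R[i])
  (fE : f = spline N c) (f_neq0 : f <> (fun=> 0))
  (xi1 xi2 : R[i]) (hxi : optimal_phases c xi1 xi2)
  (cond_i : forall k : int,
    (Kminus c - N%:R%:E + 1%:E < eint k < Kplus c + 1%:E)%E ->
    \sum_(l < N.-1) `|c (k + (l : nat)%:Z)| <> 0)
  (cond_ii : Kset c xi1 xi2 !=set0 ->
    forall k : int,
    (kappa_minus c xi1 + 1%:E <= eint k)%E ->
    (eint k <= kappa_plus c xi1 xi2 + N%:R%:E - 3%:E)%E ->
    \sum_(n1 \in [set n : int | k - N%:Z + 2 <= n <= k])
      \sum_(n2 \in [set n : int | n1 < n <= k])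
        `|complex.Im (c n1 * (c n2)^*%C)| <> 0)
  (g : R -> R[i]) (hg : g \in spline_space R N)
  (g_Gamma : forall (x : R) (k : int), x \in Gamma ->
    `|g (x + k%:~R)| = `|f (x + k%:~R)|)
  (g_Gamma' : forall (x : R) (k : int), x \in Gamma' ->
    `|cderive g (x + k%:~R)| = `|cderive f (x + k%:~R)|) :
  exists2 z : R[i], `|z| = 1 &
    (forall x : R, g x = z * f x) \/ (forall x : R, g x = z * (f x)^*%C).
Proof.
move: hg; rewrite inE => -[d gE].
case: N hN cardGamma cardGamma' fE cond_i cond_ii gE => [|[|[|n]]]// _ cG cG' fE ci cii gE.
have either : forall k, unimodular_multiple c d (window n.+3 k) \/
            unimodular_multiple (fun l => (c l)^*%C) d (window n.+3 k).
  by apply: (window_dichotomy _ _ Gamma Gamma') => // x k xG;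
    rewrite -fE -gE; [exact: g_Gamma|exact: g_Gamma'].
have vsplit := vanishing_overlap_split n.+3 c isT ci.
have [lin|antilin] := global_alternative _ _ _ either (aligned_overlap_split _ _ _ _ hxi cii).
  have [z z1 dE] := global_phase _ _ _ (ltn0Sn n.+2) lin vsplit.
  exists z => //; left=> x; rewrite fE gE; apply: splineZ => l; exact: dE.
have vconj A : vanishes c A <-> vanishes (fun l => (c l)^*%C) A.
  split=> v l Al; first by rewrite v// conjc0.
  by have /eqP := v _ Al; rewrite conjc_eq0 => /eqP.
have [|z z1 dE] := global_phase _ _ _ (ltn0Sn n.+2) antilin.
  by move=> k /vconj/vsplit[] h; [left|right] => j jk; apply/vconj/h.
exists z => //; right=> x; rewrite fE gE -spline_conj; apply: splineZ => l; exact: dE.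
Qed.
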